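(* Let $R$ be an arbitrary $R$-matrix (a complex $n^2\times n^2$ matrix solving the Yang–Baxter equation $R_{12}R_{23}R_{12}=R_{23}R_{12}R_{23}$), treated as the matrix of a linear operator in $V^{\otimes2}$, $\dim V=n$, and let $\mathcal{L}_q$ be the reflection equation algebra generated by the entries $\hat l_i^{\,j}$ of $\hat L$ with relations $$R_{12}\hat L_1R_{12}\hat L_1-\hat L_1R_{12}\hat L_1R_{12}=0 .$$ Let $k\ge1$ and let $\alpha\neq0$ be an arbitrary complex number. Define a linear map $\theta_k:\mathcal{L}_q\to\mathrm{End}(V^{\otimes k})$ by $$\theta_k(e_{\mathcal{L}})=\mathrm{id}_{V^{\otimes k}},\qquad \theta_k(\hat L_{k+1})=\alpha\,J_{k+1},\qquad \theta_k(\hat l_1\cdot\hat l_2\cdots\hat l_m)=\theta_k(\hat l_1)\cdot\theta_k(\hat l_2)\cdots\theta_k(\hat l_m)$$ for any generators $\hat l_1,\dots,\hat l_m$, where $e_{\mathcal L}$ is the unit of $\mathcal{L}_q$ and $$J_{k+1}=R_kR_{k-1}\cdots R_1R_1R_2\cdots R_k .$$ Then $\theta_k$ realizes a representation of $\mathcal{L}_q$ in the space $V^{\otimes k}$.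
   Context: Lower indices of a matrix enumerate rows, upper indices columns. Subscripts of a matrix indicate the tensor factors in which it acts, $R_i:=R_{i\,i+1}$, and $\hat L=\|\hat l_i^{\,j}\|$ is the $n\times n$ matrix of generators, $\hat L_1=\hat L\otimes I$. In $\theta_k(\hat L_{k+1})=\alpha J_{k+1}$, the matrix $J_{k+1}$ acts in $k+1$ tensor factors $V^{\otimes k}\otimes\mathbb{C}^n$: factors $1,\dots,k$ are the representation space $V^{\otimes k}$ and the $(k+1)$-th factor carries the matrix indices of the generators, i.e. $\theta_k(\hat l_i^{\,j})$ is the $n^k\times n^k$ matrix $\alpha\,(J_{k+1})^{\;\cdots\,j}_{\;\cdots\,i}$. Elements of $\mathrm{End}(V^{\otimes k})$ are identified with their matrices, multiplied by ordinary matrix multiplication. *)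

(* Defs.v *)
From HB Require Import structures.
From mathcomp Require Import all_boot all_order all_algebra.
From mathcomp Require Import complex boolp reals.
From mathcomp.multinomials Require Import monalg.

Set Implicit Arguments.
Unset Strict Implicit.
Unset Printing Implicit Defensive.

Import GRing.Theory.
Local Open Scope ring_scope.
Local Open Scope quotient_scope.

(* An n^m x n^m matrix: an operator on V^{(x) m}, dim V = n.  Rows and columns
   are indexed by multi-indices 'I_m -> 'I_n, numbered by [enum_rank]; tensor
   factors are numbered from 0.  The row index is the lower one. *)
Notation "''TM[' S ]_ ( n , m )" := 'M[S]_(#|{: {ffun 'I_m -> 'I_n}}|)
  (at level 8, S at level 200, n, m at level 50, format "''TM[' S ]_ ( n ,  m )").

Section TensorMatrices.
Variables (S : pzRingType) (n : nat).

Definition tent m (A : 'TM[S]_(n, m)) (a b : {ffun 'I_m -> 'I_n}) : S :=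
  A (enum_rank a) (enum_rank b).

Definition tmx m (f : {ffun 'I_m -> 'I_n} -> {ffun 'I_m -> 'I_n} -> S) :
  'TM[S]_(n, m) := \matrix_(x, y) f (enum_val x) (enum_val y).

(* The operator A on V^{(x) p} acting in the factors s 0, ..., s (p - 1) of
   V^{(x) m} and as the identity in the others; meaningful for injective s. *)
Definition legs p m (s : 'I_p -> 'I_m) (A : 'TM[S]_(n, p)) : 'TM[S]_(n, m) :=
  tmx (fun a b =>
    if [forall i, (i \notin codom s) ==> (a i == b i)]
    then tent A [ffun q => a (s q)] [ffun q => b (s q)] else 0).

(* R in the adjacent factors i, i + 1 of m + 1 factors; meaningful for i < m. *)
Definition adj m (R : 'TM[S]_(n, 2)) (i : nat) : 'TM[S]_(n, m.+1) :=
  legs (fun q : 'I_2 => inord (i + q)%N) R.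

Definition yang_baxter (R : 'TM[S]_(n, 2)) : Prop :=
  adj 2 R 0 *m adj 2 R 1 *m adj 2 R 0 = adj 2 R 1 *m adj 2 R 0 *m adj 2 R 1.

(* J_{k+1} = R_k ... R_1 R_1 ... R_k in k + 1 factors; R_i is [adj k R i.-1]. *)
Definition JM k (R : 'TM[S]_(n, 2)) : 'TM[S]_(n, k.+1) :=
  (\prod_(i < k) adj k R (rev_ord i)) * (\prod_(i < k) adj k R i).

Definition extend k (a : {ffun 'I_k -> 'I_n}) (i : 'I_n) :
  {ffun 'I_k.+1 -> 'I_n} :=
  [ffun q => if unlift ord_max q is Some r then a r else i].

(* The operator on the first k factors obtained from A by fixing the lower
   index i and the upper index j in the last factor. *)
Definition last_block k (A : 'TM[S]_(n, k.+1)) (i j : 'I_n) : 'TM[S]_(n, k) :=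
  tmx (fun a b => tent A (extend a i) (extend b j)).

End TensorMatrices.

Section PresentedAlgebra.
Variables (F : fieldType) (A : algType F).

Definition ideal2 (I : A -> Prop) : Prop :=
  [/\ I 0, forall x y, I x -> I y -> I (x + y),
      forall a x, I x -> I (a * x) & forall a x, I x -> I (x * a)].

(* Membership in the two-sided ideal generated by rel. *)
Definition gen_ideal (rel : A -> Prop) : pred A := fun x =>
  `[< forall I, ideal2 I -> (forall y, rel y -> I y) -> I x >].

Variable rel : A -> Prop.

Lemma gen_ideal2 : ideal2 (gen_ideal rel).
Proof.
split=> [|x y /asboolP Ix /asboolP Iy|a x /asboolP Ix|a x /asboolP Ix];
  apply/asboolP => I I2 relI; have [I0 ID IMl IMr] := I2.
- exact: I0.
- by apply: ID; [apply: Ix | apply: Iy].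
- by apply: IMl; apply: Ix.
- by apply: IMr; apply: Ix.
Qed.

Lemma gen_ideal_zmod : zmod_closed (gen_ideal rel).
Proof.
case: gen_ideal2 => I0 ID IMl _; split=> [|x y Ix Iy]; first exact: I0.
by apply: ID => //; rewrite -mulN1r; apply: IMl.
Qed.

HB.instance Definition _ :=
  GRing.isZmodClosed.Build A (gen_ideal rel) gen_ideal_zmod.

Let relI : zmodClosed A := GRing.ZmodClosed.clone A (gen_ideal rel) _.

(* The quotient algebra A / (rel). *)
Definition presented : Type := Quotient.quot relI.

HB.instance Definition _ := GRing.Zmodule.on presented.
HB.instance Definition _ := EqQuotient.on presented.

Local Notation p := (\pi_presented).

Lemma pres_eqP x y : reflect (p x = p y) (x - y \in gen_ideal rel).
Proof. by rewrite (Quotient.idealrBE relI); apply: eqP. Qed.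

Lemma pres_piD x y : p (x + y) = p x + p y.
Proof. by rewrite [LHS](Quotient.pi_add relI). Qed.

Definition pres_one : presented := p 1.
Definition pres_mul (u v : presented) : presented := p (repr u * repr v).
Definition pres_scale (c : F) (u : presented) : presented := p (c *: repr u).

Lemma pres_piM x y : pres_mul (p x) (p y) = p (x * y).
Proof.
have [_ ID IMl IMr] := gen_ideal2.
apply/pres_eqP; set x' := repr _; set y' := repr _.
have -> : x' * y' - x * y = (x' - x) * y' + x * (y' - y).
  by rewrite mulrBl mulrBr addrA subrK.
have Ix : gen_ideal rel (x' - x) by apply/pres_eqP; rewrite reprK.
have Iy : gen_ideal rel (y' - y) by apply/pres_eqP; rewrite reprK.
by apply: ID; [apply: IMr | apply: IMl].
Qed.

Lemma pres_piZ c x : pres_scale c (p x) = p (c *: x).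
Proof.
have [_ _ IMl _] := gen_ideal2.
apply/pres_eqP; rewrite -scalerBr -mulr_algl; apply: IMl.
by apply/pres_eqP; rewrite reprK.
Qed.

Lemma pres_mulA : associative pres_mul.
Proof.
move=> u v w; rewrite -[u]reprK -[v]reprK -[w]reprK.
by rewrite (pres_piM (repr v)) (pres_piM (repr u) (repr v)) !pres_piM mulrA.
Qed.
Lemma pres_mul1 : left_id pres_one pres_mul.
Proof. by move=> u; rewrite -[u]reprK pres_piM mul1r. Qed.
Lemma pres_mulr1 : right_id pres_one pres_mul.
Proof. by move=> u; rewrite -[u]reprK pres_piM mulr1. Qed.
Lemma pres_mulDl : left_distributive pres_mul +%R.
Proof.
move=> u v w; rewrite -[u]reprK -[v]reprK -[w]reprK.
by rewrite -pres_piD !pres_piM -pres_piD mulrDl.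
Qed.
Lemma pres_mulDr : right_distributive pres_mul +%R.
Proof.
move=> u v w; rewrite -[u]reprK -[v]reprK -[w]reprK.
by rewrite -pres_piD !pres_piM -pres_piD mulrDr.
Qed.

HB.instance Definition _ := GRing.Zmodule_isPzRing.Build presented
  pres_mulA pres_mul1 pres_mulr1 pres_mulDl pres_mulDr.

Lemma pres_scaleA a b u :
  pres_scale a (pres_scale b u) = pres_scale (a * b) u.
Proof. by rewrite -[u]reprK (pres_piZ b) !pres_piZ scalerA. Qed.
Lemma pres_scale1 : left_id 1 pres_scale.
Proof. by move=> u; rewrite -[u]reprK pres_piZ scale1r. Qed.
Lemma pres_scaleDr : right_distributive pres_scale +%R.
Proof.
move=> c u v; rewrite -[u]reprK -[v]reprK.
by rewrite -pres_piD !pres_piZ -pres_piD scalerDr.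
Qed.
Lemma pres_scaleDl u : {morph pres_scale^~ u : a b / a + b}.
Proof. by move=> a b; rewrite -[u]reprK !pres_piZ -pres_piD scalerDl. Qed.

HB.instance Definition _ := GRing.Zmodule_isLmodule.Build F presented
  pres_scaleA pres_scale1 pres_scaleDr pres_scaleDl.

(* The algebra axioms.  No algebra instance is declared: the library's algebra
   structures require 1 != 0, which fails for an arbitrary rel. *)
Lemma pres_scaleAl (c : F) (u v : presented) : c *: (u * v) = (c *: u) * v.
Proof.
change (pres_scale c (pres_mul u v) = pres_mul (pres_scale c u) v).
rewrite -[u]reprK -[v]reprK (pres_piM (repr u)) (pres_piZ c (repr u)).
by rewrite pres_piZ pres_piM scalerAl.
Qed.

Lemma pres_scaleAr (c : F) (u v : presented) : c *: (u * v) = u * (c *: v).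
Proof.
change (pres_scale c (pres_mul u v) = pres_mul u (pres_scale c v)).
rewrite -[u]reprK -[v]reprK (pres_piM (repr u)) (pres_piZ c (repr v)).
by rewrite pres_piZ pres_piM scalerAr.
Qed.

End PresentedAlgebra.

Section ReflectionEquationAlgebra.
Variables (F : fieldType) (n : nat) (R : 'TM[F]_(n, 2)).

(* The free associative unital algebra on the n^2 letters (i, j). *)
Definition free_alg : Type := {malg F[{fmonom ('I_n * 'I_n)%type}]}.

HB.instance Definition _ := GRing.Lalgebra.on free_alg.

Lemma free_scaleAr (c : F) (x y : free_alg) : c *: (x * y) = x * (c *: y).
Proof.
rewrite -!mul_malgC !mulrA; congr (_ * y).
rewrite !malgM_def fgmulUg fgmulgU; apply: eq_bigr => w _.
by rewrite mulrC mul1m mulm1.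
Qed.

HB.instance Definition _ := GRing.Lalgebra_isAlgebra.Build F free_alg
  free_scaleAr.

Definition free_gen (i j : 'I_n) : free_alg := << fmu (i, j) >>.

(* The n x n matrix of generators: row = lower index, column = upper index. *)
Definition free_L : 'TM[free_alg]_(n, 1) :=
  tmx (fun a b => free_gen (a ord0) (b ord0)).

(* R_12 L_1 R_12 L_1 - L_1 R_12 L_1 R_12 with entries in the free algebra. *)
Definition RE_mx : 'TM[free_alg]_(n, 2) :=
  let R12 := map_mx (fun c : F => c%:A) R in
  let L1 := legs (fun _ : 'I_1 => ord0 : 'I_2) free_L in
  R12 *m L1 *m R12 *m L1 - L1 *m R12 *m L1 *m R12.

Definition RE_rel (x : free_alg) : Prop := exists u v, x = RE_mx u v.

(* The reflection equation algebra. *)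
Definition REA : Type := presented RE_rel.

HB.instance Definition _ := GRing.PzRing.on REA.
HB.instance Definition _ := GRing.Lmodule.on REA.

Definition REA_gen (i j : 'I_n) : REA :=
  \pi_(presented RE_rel) (free_gen i j).

(* The conditions that define theta_k on the unit, the generators and the
   products of generators. *)
Definition theta_spec k (alpha : F) (theta : REA -> 'TM[F]_(n, k)) : Prop :=
  [/\ linear theta,
      theta 1 = 1%:M,
      forall i j, theta (REA_gen i j) = alpha *: last_block (JM k R) i j
    & forall w : seq ('I_n * 'I_n),
        theta (\prod_(x <- w) REA_gen x.1 x.2) =
        \prod_(x <- w) theta (REA_gen x.1 x.2)].

(* A representation on a space of dimension m, in matrix form. *)
Definition is_representation m (rho : REA -> 'M[F]_m) : Prop :=
  linear rho /\ GRing.monoid_morphism rho.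

End ReflectionEquationAlgebra.

(* Main.v *)
Require Import Defs.
From mathcomp Require Import all_boot all_order all_algebra.
From mathcomp Require Import complex boolp reals.
From mathcomp Require Import finmap generic_quotient zify.
From mathcomp.multinomials Require Import monalg.

Set Implicit Arguments.
Unset Strict Implicit.
Unset Printing Implicit Defensive.

Import GRing.Theory.
Local Open Scope ring_scope.
Local Open Scope quotient_scope.

(** A representation of an algebra given by generators and relations is an
    assignment of matrices to the generators under which the relations hold,
    so the content is that alpha J_{k+1} satisfies the reflection equation.

    Let V^{(x) k} be followed by two copies of C^n, the factors k+1 and k+2 in
    which the matrices of the reflection equation act.  Substituting
    alpha J_{k+1} for the matrix of generators turns R_12 into R_{k+1} and L_1
    into alpha J_{k+1}; since R J_{k+1} R = J_{k+2} for R = R_{k+1}, the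
    equation becomes alpha^2 (J_{k+2} J_{k+1} - J_{k+1} J_{k+2}) = 0
    ([realizesM], [jm_entry_rel]).  That these Jucys-Murphy elements commute follows
    from the braid relations alone, without inverting R: J_{k+2} commutes with
    each of R_1, ..., R_k ([jm_near]), and J_{k+1} is a product of these.

    The braid relations for the R_i come from the Yang-Baxter equation on
    V^{(x) 3} because the insertion of an operator into chosen tensor factors is
    a ring morphism compatible with iterated insertions ([legsM],
    [legs_legs]), and because operators in disjoint factors commute
    ([legsC]).

    Uniqueness holds because words in the generators span the algebra
    ([linear_on_words]). *)

(** * Entries of tensor operators *)

Section TensorCalculus.
Variables (S : pzRingType) (n : nat).

Lemma tent_tmx m (f : {ffun 'I_m -> 'I_n} -> {ffun 'I_m -> 'I_n} -> S) a b :
  tent (tmx f) a b = f a b.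
Proof. by rewrite /tent mxE !enum_rankK. Qed.

Lemma tentP m (A B : 'TM[S]_(n, m)) :
  (forall a b, tent A a b = tent B a b) -> A = B.
Proof.
move=> eqAB; apply/matrixP=> x y.
by have := eqAB (enum_val x) (enum_val y); rewrite /tent !enum_valK.
Qed.

Lemma tent_mul m (A B : 'TM[S]_(n, m)) a b :
  tent (A *m B) a b = \sum_c tent A a c * tent B c b.
Proof.
rewrite /tent mxE (reindex enum_rank) //.
by exists enum_val => x _; rewrite ?enum_rankK ?enum_valK.
Qed.

Lemma tent1 m a b : tent (1%:M : 'TM[S]_(n, m)) a b = (a == b)%:R.
Proof. by rewrite /tent mxE (inj_eq enum_rank_inj). Qed.

Definition pull p m (s : 'I_p -> 'I_m) (a : {ffun 'I_m -> 'I_n}) :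
  {ffun 'I_p -> 'I_n} := [ffun q => a (s q)].

Definition agree_off p m (s : 'I_p -> 'I_m) (a b : {ffun 'I_m -> 'I_n}) :=
  [forall i, (i \notin codom s) ==> (a i == b i)].

Lemma agree_offP p m (s : 'I_p -> 'I_m) (a b : {ffun 'I_m -> 'I_n}) :
  reflect (forall i, i \notin codom s -> a i = b i) (agree_off s a b).
Proof.
by apply: (iffP forallP) => ab i; [move/implyP: (ab i) => h /h/eqP
  | apply/implyP=> /ab ->].
Qed.

Lemma tent_legs p m (s : 'I_p -> 'I_m) (A : 'TM[S]_(n, p)) a b :
  tent (legs s A) a b =
  if agree_off s a b then tent A (pull s a) (pull s b) else 0.
Proof. by rewrite tent_tmx. Qed.

Lemma eq_legs p m (s t : 'I_p -> 'I_m) (A : 'TM[S]_(n, p)) :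
  s =1 t -> legs s A = legs t A.
Proof.
move=> st; apply: tentP => a b; rewrite !tent_legs.
have -> : agree_off s a b = agree_off t a b.
  by apply: eq_forallb => i; rewrite (eq_codom st).
by congr (if _ then tent A _ _ else _); apply/ffunP=> q; rewrite !ffunE st.
Qed.

(** * Insertion into chosen tensor factors *)

Section Injective.
Variables (p m : nat) (s : 'I_p -> 'I_m).
Hypothesis s_inj : injective s.

Let put (a : {ffun 'I_m -> 'I_n}) (d : {ffun 'I_p -> 'I_n}) :
    {ffun 'I_m -> 'I_n} :=
  [ffun i => if [pick q | s q == i] is Some q then d q else a i].

Let put_in a d q : put a d (s q) = d q.
Proof.
rewrite ffunE; case: pickP => [r /eqP/s_inj -> //|/(_ q)].
by rewrite eqxx.
Qed.

Let put_out a d i : i \notin codom s -> put a d i = a i.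
Proof.
by rewrite ffunE; case: pickP => // q /eqP <-; rewrite codom_f.
Qed.

Lemma pull_agree_off_inj (a b : {ffun 'I_m -> 'I_n}) :
  agree_off s a b -> pull s a = pull s b -> a = b.
Proof.
move=> /agree_offP ab sab; apply/ffunP=> i.
have [/codomP[q ->]|/ab //] := boolP (i \in codom s).
by have /ffunP/(_ q) := sab; rewrite !ffunE.
Qed.

(** In the sum over intermediate multi-indices c only those that agree with a
    outside the chosen factors contribute, and such a c amounts to its
    restriction to the chosen factors. *)
Lemma legsM (A B : 'TM[S]_(n, p)) : legs s (A *m B) = legs s A *m legs s B.
Proof.
apply: tentP => a b; rewrite tent_legs !tent_mul.
have pull_put d : pull s (put a d) = d.
  by apply/ffunP=> q; rewrite [LHS]ffunE put_in.
have agr_put d : agree_off s a (put a d).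
  by apply/agree_offP=> i si; rewrite put_out.
have putK c : agree_off s a c -> put a (pull s c) = c.
  move=> ac; apply: pull_agree_off_inj; last by rewrite pull_put.
  apply/agree_offP=> i si; rewrite put_out //.
  exact: (agree_offP _ _ _ ac).
rewrite (bigID (agree_off s a)) /= [X in _ = _ + X]big1 ?addr0; last first.
  by move=> c /negPf ac; rewrite tent_legs ac mul0r.
rewrite (reindex_onto (put a) (pull s)) //=.
rewrite [RHS](eq_bigl xpredT) => [|d]; last by rewrite agr_put pull_put eqxx.
have agr_b d : agree_off s (put a d) b = agree_off s a b.
  by apply: eq_forallb => i; apply: implyb_id2l => si; rewrite put_out.
case: ifP => ab.
  by apply: eq_bigr => d _; rewrite !tent_legs agr_put agr_b ab !pull_put.
by rewrite big1 // => d _; rewrite [X in _ * X]tent_legs agr_b ab mulr0.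
Qed.

Lemma legs1 : legs s (1%:M : 'TM[S]_(n, p)) = 1%:M.
Proof.
apply: tentP => a b; rewrite tent_legs !tent1.
have [->|neq_ab] := eqVneq a b.
  by rewrite eqxx; case: ifP => // /agree_offP[].
case: ifP => // ab; case: eqP => // /(pull_agree_off_inj ab) eq_ab.
by rewrite eq_ab eqxx in neq_ab.
Qed.

(** Allows relations between adjacent R-matrices to be moved from V^{(x) 3} to
    any three consecutive factors, and J_{k+1} to be read in k + 2 factors. *)
Lemma legs_legs q (t : 'I_q -> 'I_p) (A : 'TM[S]_(n, q)) :
  legs s (legs t A) = legs (s \o t) A.
Proof.
apply: tentP => a b; rewrite !tent_legs.
have -> : pull (s \o t) a = pull t (pull s a) by apply/ffunP=> i; rewrite !ffunE.
have -> : pull (s \o t) b = pull t (pull s b) by apply/ffunP=> i; rewrite !ffunE.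
suff -> : agree_off (s \o t) a b =
    agree_off s a b && agree_off t (pull s a) (pull s b) by case: ifP.
apply/agree_offP/andP => [ab|[/agree_offP sab /agree_offP tab] i sti].
  split; apply/agree_offP=> i ni.
    by apply: ab; apply: contra ni => /codomP[r ->]; rewrite /= codom_f.
  rewrite !ffunE; apply: ab; apply: contra ni => /codomP[r /s_inj ->].
  exact: codom_f.
have [/codomP[r ir]|/sab //] := boolP (i \in codom s).
have := tab r; rewrite !ffunE -ir; apply.
apply: contra sti => /codomP[u ru]; rewrite ir ru.
by rewrite -[s (t u)]/((s \o t) u) codom_f.
Qed.

End Injective.
End TensorCalculus.

Section CommutingLegs.
Variables (S : comPzRingType) (n : nat).

(** The right-hand side is symmetric in the two operators up to the order of
    the scalar factors, which is why operators in disjoint factors commute. *)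
Lemma tent_mul_legs p q m (s : 'I_p -> 'I_m) (t : 'I_q -> 'I_m)
    (A : 'TM[S]_(n, p)) (B : 'TM[S]_(n, q)) a b :
  (forall i, i \in codom s -> i \notin codom t) ->
  tent (legs s A *m legs t B) a b =
  if [forall i, (i \notin codom s) && (i \notin codom t) ==> (a i == b i)]
  then tent A (pull s a) (pull s b) * tent B (pull t a) (pull t b) else 0.
Proof.
(* The only intermediate multi-index with a nonzero contribution. *)
move=> dis; pose c0 : {ffun 'I_m -> 'I_n} :=
  [ffun i => if i \in codom s then b i else a i].
rewrite tent_mul (bigD1 c0) //= big1 ?addr0 => [|c c_neq]; last first.
  rewrite !tent_legs; case: ifP => ac; last by rewrite mul0r.
  case: ifP => cb; last by rewrite mulr0.
  case/eqP: c_neq; apply/ffunP=> i; rewrite ffunE; case: ifP => si.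
    by apply: (agree_offP _ _ _ cb); apply: dis.
  by rewrite (agree_offP _ _ _ ac) ?si.
have -> : tent (legs s A) a c0 = tent A (pull s a) (pull s b).
  rewrite tent_legs ifT; first congr tent.
    by apply/ffunP=> i; rewrite !ffunE codom_f.
  by apply/agree_offP=> i /negPf si; rewrite ffunE si.
rewrite tent_legs.
have -> : pull t c0 = pull t a.
  apply/ffunP=> i; rewrite !ffunE; case: ifP => // /dis.
  by rewrite codom_f.
have -> : agree_off t c0 b =
    [forall i, (i \notin codom s) && (i \notin codom t) ==> (a i == b i)].
  apply: eq_forallb => i; rewrite ffunE.
  by case: ifP => //=; rewrite eqxx implybT.
by case: ifP => //; rewrite mulr0.
Qed.

Lemma legsC p q m (s : 'I_p -> 'I_m) (t : 'I_q -> 'I_m)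
    (A : 'TM[S]_(n, p)) (B : 'TM[S]_(n, q)) :
  (forall i j, s i != t j) ->
  legs s A *m legs t B = legs t B *m legs s A.
Proof.
move=> dis; apply: tentP => a b; rewrite !tent_mul_legs.
- by under eq_forallb do rewrite andbC; rewrite mulrC.
- by move=> i /codomP[u ->]; apply/negP=> /codomP[v /esym/eqP]; apply/negP.
- by move=> i /codomP[u ->]; apply/negP=> /codomP[v /eqP]; apply/negP.
Qed.

Lemma adj_far m (R : 'TM[S]_(n, 2)) i j :
  (i.+1 < j)%N -> (j < m)%N ->
  adj m R i *m adj m R j = adj m R j *m adj m R i.
Proof.
move=> ij jm; apply: legsC => u v; rewrite -val_eqE /= !inordK;
  have := ltn_ord u; have := ltn_ord v; lia.
Qed.

Lemma inord_shift_inj p m i : (i + p <= m.+1)%N ->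
  injective (fun q : 'I_p => inord (i + q) : 'I_m.+1).
Proof.
move=> im u v /(congr1 val) /=; have u3 := ltn_ord u; have v3 := ltn_ord v.
by rewrite !inordK => [uv||]; try lia; apply: val_inj => /=; lia.
Qed.

Lemma adj_legs3 m (R : 'TM[S]_(n, 2)) i e :
  (i.+1 < m)%N -> (e < 2)%N ->
  legs (fun q : 'I_3 => inord (i + q) : 'I_m.+1) (adj 2 R e) =
  adj m R (i + e).
Proof.
move=> im e2; rewrite legs_legs; last by apply: inord_shift_inj; lia.
apply: eq_legs => q /=; apply: val_inj; have q2 := ltn_ord q.
by rewrite /= !inordK; lia.
Qed.

Lemma adj_braid m (R : 'TM[S]_(n, 2)) i : yang_baxter R -> (i.+1 < m)%N ->
  adj m R i *m adj m R i.+1 *m adj m R i =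
  adj m R i.+1 *m adj m R i *m adj m R i.+1.
Proof.
move=> YB im.
have R0 := adj_legs3 R im (isT : (0 < 2)%N); rewrite addn0 in R0.
have R1 := adj_legs3 R im (isT : (1 < 2)%N); rewrite addn1 in R1.
have inj3 : injective (fun q : 'I_3 => inord (i + q) : 'I_m.+1).
  by apply: inord_shift_inj; lia.
by rewrite -R0 -R1 -!legsM // YB.
Qed.

End CommutingLegs.

(** * Commutation of Jucys-Murphy elements *)

Section JucysMurphy.
Variables (T : pzRingType) (r : nat -> T) (m : nat).
Hypothesis braid : forall i, (i.+1 < m)%N ->
  r i * r i.+1 * r i = r i.+1 * r i * r i.+1.
Hypothesis far : forall i j, (i.+1 < j)%N -> (j < m)%N -> r i * r j = r j * r i.

(** The recursion J_{k+2} = R_{k+1} J_{k+1} R_{k+1}, with numbering shifted so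
    that [jm k] is the product r_{k-1} ... r_0 r_0 ... r_{k-1}. *)
Fixpoint jm k : T := if k is k'.+1 then r k' * jm k' * r k' else 1.

Lemma jm_far k j : (k < j)%N -> (j < m)%N -> GRing.comm (r j) (jm k).
Proof.
elim: k => [|k IHk] kj jm; first exact: commr1.
have rk : GRing.comm (r j) (r k) by apply/esym/far.
by apply: commrM => //; apply: commrM => //; apply: IHk => //; apply: ltnW.
Qed.

(** By the recursion it is enough to treat i = k - 2.  With s = r_i and
    t = r_{i+1}, the braid relation is used on both sides of J = [jm i], which
    commutes with t:
    s (t s J s t) = t s t J s t = t s J (t s t) = t s J s t s. *)
Lemma jm_near k i : (i.+1 < k)%N -> (k <= m)%N -> GRing.comm (r i) (jm k).
Proof.
elim: k => [//|k IHk]; rewrite ltnS leq_eqVlt => /orP[/eqP <-|ik] km; last first.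
  have rk : GRing.comm (r i) (r k) by apply: far.
  by apply: commrM => //; apply: commrM => //; apply: IHk => //; apply: ltnW.
have J := jm_far (ltnSn i) km.
have B := braid km; rewrite /GRing.comm /= !mulrA B.
rewrite -[_ * r i.+1 * jm i]mulrA J -!mulrA; congr (_ * (_ * (_ * _))).
by rewrite !mulrA B.
Qed.

Lemma jm_comm k : (k < m)%N -> GRing.comm (jm k.+1) (jm k).
Proof.
move=> km; have near i : (i < k)%N -> GRing.comm (jm k.+1) (r i).
  by move=> ik; apply/commr_sym/jm_near.
suff sub l : (l <= k)%N -> GRing.comm (jm k.+1) (jm l) by apply: sub.
elim: l => [|l IHl] lk; first exact: commr1.
have [rl jl] := (near l lk, IHl (ltnW lk)).
by apply: commrM => //; apply: commrM.
Qed.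

Lemma jm_prod k :
  (\prod_(i < k) r (rev_ord i)) * (\prod_(i < k) r i) = jm k.
Proof.
elim: k => [|k IHk]; first by rewrite !big_ord0 mulr1.
by rewrite big_ord_recl big_ord_recr /= -IHk subn1 !mulrA.
Qed.

End JucysMurphy.

(** * Splitting off the last two factors *)

Section Blocks.
Variables (F : comPzRingType) (n k : nat) (R : 'TM[F]_(n, 2)).

Lemma extend_lift m (a : {ffun 'I_m -> 'I_n}) i q :
  extend a i (lift ord_max q) = a q.
Proof. by rewrite ffunE liftK. Qed.

Lemma extend_max m (a : {ffun 'I_m -> 'I_n}) i : extend a i ord_max = i.
Proof. by rewrite ffunE unlift_none. Qed.

(** [lift ord_max] is the inclusion of the first factors, which adds an idle
    last factor. *)
Lemma legs_lift_adj m i : (i < m)%N ->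
  legs (lift ord_max) (adj m R i) = adj m.+1 R i.
Proof.
move=> im; rewrite legs_legs; last exact: lift_inj.
apply: eq_legs => q; apply: val_inj; have q2 := ltn_ord q.
by rewrite [LHS]lift_max /= !inordK; lia.
Qed.

Lemma legs_lift_JM m :
  legs (lift ord_max) (JM m R) = jm (adj m.+1 R) m :> 'TM[F]_(n, m.+2).
Proof.
have li := @lift_inj m.+2 ord_max.
pose L (A : 'TM[F]_(n, m.+1)) : 'TM[F]_(n, m.+2) := legs (lift ord_max) A.
have LM : {morph L : A B / A * B} by move=> A B; apply: legsM.
have L1 : L 1 = 1 by apply: legs1.
rewrite -/(L _) /JM LM !(big_morph L LM L1) -jm_prod.
by congr (_ * _); apply: eq_bigr => i _; apply: legs_lift_adj.
Qed.

Definition extend2 (a : {ffun 'I_k -> 'I_n}) (c : {ffun 'I_2 -> 'I_n}) :=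
  extend (extend a (c ord0)) (c ord_max).

Definition block2 (A : 'TM[F]_(n, k.+2)) c d : 'TM[F]_(n, k) :=
  tmx (fun a b => tent A (extend2 a c) (extend2 b d)).

Lemma extend2_bij : bijective (fun p => extend2 p.1 p.2).
Proof.
exists (fun e : {ffun 'I_k.+2 -> 'I_n} =>
  ([ffun q => e (lift ord_max (lift ord_max q))],
   [ffun q : 'I_2 => if q == ord0 then e (lift ord_max ord_max)
                     else e ord_max])) => [[a c]|e] /=.
  congr pair; apply/ffunP=> q; rewrite ffunE ?extend_lift //.
  by case: q => [[|[|//]]] q2; rewrite ?extend_lift ?extend_max;
    congr (c _); apply: val_inj.
apply/ffunP=> i; case: (unliftP ord_max i) => [j ->|->].
  rewrite extend_lift; case: (unliftP ord_max j) => [q ->|->].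
    by rewrite extend_lift ffunE.
  by rewrite extend_max ffunE.
by rewrite extend_max ffunE.
Qed.

(** An operator on V^{(x) k} (x) (C^n)^{(x) 2} is an n^2 x n^2 matrix with
    entries in End(V^{(x) k}), multiplied as such. *)
Lemma block2M (A B : 'TM[F]_(n, k.+2)) c d :
  block2 (A *m B) c d = \sum_e block2 A c e *m block2 B e d.
Proof.
apply: tentP => a b; rewrite tent_tmx tent_mul.
rewrite (reindex (fun p => extend2 p.1 p.2)) /=; last first.
  exact/onW_bij/extend2_bij.
rewrite -(pair_bigA _ (fun a' e => tent A _ (extend2 a' e) *
                                 tent B (extend2 a' e) _)) exchange_big.
rewrite /tent summxE; apply: eq_bigr => e _; rewrite -/(tent (_ *m _) a b).
by rewrite tent_mul; apply: eq_bigr => a' _; rewrite !tent_tmx.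
Qed.

End Blocks.

(** * Evaluation of noncommutative polynomials at matrices *)

Section WordEvaluation.
Variables (F : comNzRingType) (I : choiceType) (N : nat) (M : I -> 'M[F]_N).

(** Matrices of size 0, which form the zero ring, have to be allowed as values:
    they occur when n = 0. *)
Definition weval (x : {malg F[{fmonom I}]}) : 'M[F]_N :=
  \sum_(w <- msupp x) x@_w *: \prod_(l <- w : seq I) M l.

Lemma wevalEw (d : {fset {fmonom I}}) x : (msupp x `<=` d)%fset ->
  weval x = \sum_(w <- d) x@_w *: \prod_(l <- w : seq I) M l.
Proof.
move=> le; rewrite [LHS](big_fset_incl _ le) => //= w wd /mcoeff_outdom ->.
by rewrite scale0r.
Qed.

Lemma wevalU c w : weval << c *g w >> = c *: \prod_(l <- w : seq I) M l.
Proof. by rewrite (wevalEw msuppU_le) big_seq_fset1 mcoeffUU. Qed.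

Lemma weval0 : weval 0 = 0.
Proof. by rewrite /weval msupp0 big_seq_fset0. Qed.

Lemma wevalD : {morph weval : x y / x + y}.
Proof.
move=> x y; have [lx ly] := (fsubsetUl (msupp x) (msupp y),
                             fsubsetUr (msupp x) (msupp y)).
rewrite (wevalEw (msuppD_le x y)) (wevalEw lx) (wevalEw ly) -big_split.
by apply: eq_bigr => w _; rewrite mcoeffD scalerDl.
Qed.

Lemma wevalZ c x : weval (c *: x) = c *: weval x.
Proof.
rewrite (wevalEw (msuppZ_le c x)) scaler_sumr.
by apply: eq_bigr => w _; rewrite mcoeffZ scalerA.
Qed.

Lemma weval1 : weval 1 = 1.
Proof. by rewrite wevalU fm1 big_nil scale1r. Qed.

Lemma wevalM : {morph weval : x y / x * y}.
Proof.
have eD := big_morph weval wevalD weval0.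
move=> x y; rewrite malgME eD mulr_suml; apply: eq_bigr => v _.
rewrite eD mulr_sumr; apply: eq_bigr => w _.
rewrite wevalU fmM big_cat /=.
by rewrite -[RHS]scalemxAl -[X in _ = _ *: X]scalemxAr scalerA.
Qed.

Lemma weval_gen l : weval << fmu l >> = M l.
Proof. by rewrite wevalU fmU big_seq1 scale1r. Qed.

End WordEvaluation.

(** * Maps out of the reflection equation algebra *)

Section Generators.
Variables (F : fieldType) (n : nat) (R : 'TM[F]_(n, 2)).

Definition rea_pi (x : free_alg F n) : REA R :=
  \pi_(presented (RE_rel R)) x.

Lemma rea_piD : {morph rea_pi : x y / x + y}.
Proof. by move=> x y; exact: pres_piD. Qed.

Lemma rea_piM : {morph rea_pi : x y / x * y}.
Proof. by move=> x y; rewrite -[RHS]/(pres_mul _ _) pres_piM. Qed.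

Lemma rea_piZ c : {morph rea_pi : x / c *: x}.
Proof. by move=> x; rewrite -[RHS]/(pres_scale _ _) pres_piZ. Qed.

Lemma rea_pi_word (s : seq ('I_n * 'I_n)) :
  rea_pi << FMonom s >> = \prod_(l <- s) REA_gen R l.1 l.2.
Proof.
elim: s => [|[i j] s IHs].
  by rewrite big_nil -fmoneE.
rewrite big_cons -IHs -[REA_gen _ _ _]/(rea_pi << fmu (i, j) >>) -rea_piM.
congr rea_pi; rewrite [RHS]malgM_def fgmulUU mulr1; congr << _ *g _ >>.
by apply/eqP; rewrite fmP fmM fmU.
Qed.

(** Words in the generators span the algebra, so a linear map is known once it
    is known on words; this gives uniqueness. *)
Lemma linear_on_words (N : nat) (M : 'I_n * 'I_n -> 'M[F]_N)
    (f : REA R -> 'M[F]_N) :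
  linear f ->
  (forall s : seq ('I_n * 'I_n),
     f (\prod_(l <- s) REA_gen R l.1 l.2) = \prod_(l <- s) M l) ->
  forall x, f (rea_pi x) = weval M x.
Proof.
move=> f_lin f_word x.
have fD : {morph f : u v / u + v}.
  by move=> u v; have := f_lin 1 u v; rewrite !scale1r.
have f0 : f 0 = 0 by apply: (addrI (f 0)); rewrite -fD !addr0.
have fZ c u : f (c *: u) = c *: f u.
  by have := f_lin c u 0; rewrite f0 !addr0.
have piD := rea_piD; have pi0 : rea_pi 0 = 0.
  by apply: (addrI (rea_pi 0)); rewrite -piD !addr0.
rewrite {1}[x]monalgE (big_morph rea_pi piD pi0) (big_morph f fD f0).
apply: eq_bigr => w _; rewrite -f_word -rea_pi_word -fZ -rea_piZ.
congr (f (rea_pi _)); rewrite fmK.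
by apply/malgP=> v; rewrite [RHS]mcoeffZ [LHS]mcoeffU [in RHS]mcoeffU mulr_natr.
Qed.

Variables (N : nat) (M : 'I_n * 'I_n -> 'M[F]_N).
Hypothesis M_rel : forall u v, weval M (RE_mx R u v) = 0.

Definition rea_eval (u : REA R) : 'M[F]_N := weval M (repr u).

(** The kernel of the evaluation is a two-sided ideal; containing the relations,
    it contains the ideal they generate, so the choice of the representative
    is immaterial. *)
Lemma rea_eval_pi x : rea_eval (rea_pi x) = weval M x.
Proof.
have /pres_eqP/asboolP ker : rea_pi (repr (rea_pi x)) = rea_pi x.
  exact: reprK.
have evI : ideal2 (fun y : free_alg F n => weval M y = 0).
  split=> [|y z yI zI|a y yI|a y yI]; first exact: weval0.
  - by rewrite wevalD yI zI addr0.
  - by rewrite wevalM yI mulr0.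
  - by rewrite wevalM yI mul0r.
have /(ker _ evI) : forall y, RE_rel R y -> weval M y = 0.
  by move=> y [u [v ->]].
by rewrite wevalD -scaleN1r wevalZ scaleN1r => /subr0_eq.
Qed.

Lemma rea_eval_linear : linear rea_eval.
Proof.
move=> c u v; rewrite -[u]reprK -[v]reprK -/(rea_pi _) -/(rea_pi _).
by rewrite -rea_piZ -rea_piD !rea_eval_pi wevalD wevalZ.
Qed.

Lemma rea_eval_morphism : GRing.monoid_morphism rea_eval.
Proof.
split; first by rewrite -[1]/(rea_pi 1) rea_eval_pi weval1.
move=> u v; rewrite -[u]reprK -[v]reprK -/(rea_pi _) -/(rea_pi _).
by rewrite -rea_piM !rea_eval_pi wevalM.
Qed.

Lemma rea_eval_gen i j : rea_eval (REA_gen R i j) = M (i, j).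
Proof. by rewrite -[REA_gen R i j]/(rea_pi _) rea_eval_pi weval_gen. Qed.

End Generators.

(** * The reflection equation for the Jucys-Murphy element *)

Section ReflectionEquation.
Variables (F : fieldType) (n k : nat) (R : 'TM[F]_(n, 2)) (alpha : F).

Definition jm_entry (l : 'I_n * 'I_n) : 'TM[F]_(n, k) :=
  alpha *: last_block (JM k R) l.1 l.2.

Local Notation phi := (weval jm_entry).

(** A matrix X of noncommutative polynomials, whose indices live in the factors
    k+1 and k+2, becomes the operator A when the entries of J_{k+1} are
    substituted for the generators. *)
Definition realizes (X : 'TM[free_alg F n]_(n, 2)) (A : 'TM[F]_(n, k.+2)) :=
  forall c d, phi (tent X c d) = block2 A c d.

(** The entries of X and Y are multiplied in the same order as the operators
    they stand for, so the two matrix products match without reordering. *)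
Lemma realizesM X Y A B :
  realizes X A -> realizes Y B -> realizes (X *m Y) (A *m B).
Proof.
move=> XA YB c d; rewrite tent_mul block2M.
rewrite (big_morph _ (wevalD jm_entry) (weval0 jm_entry)).
by apply: eq_bigr => e _; rewrite wevalM XA YB.
Qed.

Lemma realizesB X Y A B :
  realizes X A -> realizes Y B -> realizes (X - Y) (A - B).
Proof.
move=> XA YB c d; have -> : tent (X - Y) c d = tent X c d + -1 *: tent Y c d.
  by rewrite scaleN1r /tent !mxE.
rewrite wevalD wevalZ scaleN1r XA YB.
by apply: tentP => a b; rewrite /tent !mxE !enum_rankK /tent ?mxE.
Qed.

Lemma realizes_R :
  realizes (map_mx (fun c : F => c%:A) R) (adj k.+1 R k).
Proof.
move=> c d; have -> : tent (map_mx (fun c : F => c%:A : free_alg F n) R) c d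
   = (tent R c d)%:A by rewrite /tent mxE.
rewrite wevalZ weval1; apply: tentP => a b.
rewrite tent_tmx tent_legs.
(* The factors k+1 and k+2 carry the block indices c and d; the remaining ones,
   where R acts as the identity, carry a and b. *)
have pullE (e : {ffun 'I_k -> 'I_n}) g :
    pull (fun q : 'I_2 => inord (k + q) : 'I_k.+2) (extend2 e g) = g.
  apply/ffunP=> q; rewrite ffunE; case: q => [[|[|//]]] q2.
    have -> : inord (k + 0) = lift ord_max (ord_max : 'I_k.+1).
      by apply: ord_inj; rewrite lift_max inordK /=; lia.
    by rewrite extend_lift extend_max; congr (g _); apply: ord_inj.
  have -> : inord (k + 1) = ord_max :> 'I_k.+2.
    by apply: ord_inj; rewrite inordK /=; lia.
  by rewrite extend_max; congr (g _); apply: ord_inj.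
rewrite !pullE.
have -> : agree_off (fun q : 'I_2 => inord (k + q) : 'I_k.+2)
    (extend2 a c) (extend2 b d) = (a == b).
  apply/agree_offP/eqP=> [ab|-> i].
    apply/ffunP=> q; have := ab (lift ord_max (lift ord_max q)).
    rewrite !extend_lift; apply; apply/codomP=> -[u /(congr1 (@nat_of_ord _))].
    rewrite !lift_max /= inordK; have := ltn_ord u;
      have := ltn_ord q; lia.
  case: (unliftP ord_max i) => [j ->|->]; last first.
    case/codomP; exists ord_max.
    by apply: ord_inj; rewrite inordK /=; lia.
  case: (unliftP ord_max j) => [q ->|->]; first by rewrite !extend_lift.
  case/codomP; exists ord0.
  by apply: ord_inj; rewrite lift_max inordK /=; lia.
rewrite /tent mxE -/(tent (1%:M : 'TM[F]_(n, k)) a b) tent1.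
by case: (a == b); rewrite ?mulr1 ?mulr0.
Qed.

Lemma realizes_L :
  realizes (legs (fun _ : 'I_1 => ord0 : 'I_2) (free_L F n))
            (alpha *: jm (adj k.+1 R) k).
Proof.
move=> c d; rewrite -legs_lift_JM.
have -> : tent (legs (fun _ : 'I_1 => ord0 : 'I_2) (free_L F n)) c d =
    if c ord_max == d ord_max then free_gen F (c ord0) (d ord0) else 0.
  rewrite tent_legs tent_tmx !ffunE; congr (if _ then _ else _).
  apply/agree_offP/eqP=> [cd|cd i].
    by apply: cd; apply/codomP=> -[].
  case: i => [[|[|//]]] i2.
    by case/codomP; exists ord0; apply: ord_inj.
  by move=> _; have -> : Ordinal i2 = ord_max by apply: ord_inj.
apply: tentP => a b; rewrite tent_tmx.
have -> (A : 'TM[F]_(n, k.+2)) a' b' :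
    tent (alpha *: A) a' b' = alpha * tent A a' b' by rewrite /tent mxE.
rewrite tent_legs.
have -> : agree_off (lift ord_max) (extend2 a c) (extend2 b d) =
    (c ord_max == d ord_max).
  apply/agree_offP/eqP=> [ab|cd i].
    have := ab ord_max; rewrite !extend_max; apply.
    by apply/codomP=> -[q /eqP]; rewrite (negPf (neq_lift _ _)).
  case: (unliftP ord_max i) => [j ->|-> _]; first by rewrite codom_f.
  by rewrite !extend_max.
case: ifP => _; last by rewrite weval0 /tent mxE mulr0.
have pullE (e : {ffun 'I_k -> 'I_n}) g :
    pull (lift ord_max) (extend2 e g) = extend e (g ord0).
  by apply/ffunP=> q; rewrite ffunE extend_lift.
rewrite weval_gen !pullE /tent mxE -/(tent (last_block _ _ _) a b).
by rewrite tent_tmx.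
Qed.

(** With J = J_{k+1} and r = R_{k+1} the relation becomes
    alpha^2 ((r J r) J - J (r J r)), where r J r = J_{k+2}. *)
Lemma jm_entry_rel : yang_baxter R ->
  forall u v, phi (RE_mx R u v) = 0.
Proof.
move=> YB u v; set J := jm (adj k.+1 R) k; set r := adj k.+1 R k.
have comm : GRing.comm (r * J * r) J.
  apply: (@jm_comm _ (adj k.+1 R) k.+1) => // [i ik|i j ij jk].
    exact: adj_braid.
  exact: adj_far.
have rel : realizes (RE_mx R)
    (r *m (alpha *: J) *m r *m (alpha *: J) -
     (alpha *: J) *m r *m (alpha *: J) *m r).
  have [qR qL] := (realizes_R, realizes_L).
  by apply: realizesB; repeat apply: realizesM.
have := rel (enum_val u) (enum_val v); rewrite /tent !enum_valK => ->.
have -> : r *m (alpha *: J) *m r *m (alpha *: J) -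
     (alpha *: J) *m r *m (alpha *: J) *m r = 0.
  rewrite -!(scalemxAl, scalemxAr) -!mulmxA.
  apply/eqP; rewrite subr_eq0; apply/eqP; do 2!congr (_ *: _).
  have := comm; rewrite /GRing.comm -!mulmxE -!mulmxA; exact.
by apply: tentP => a b; rewrite /tent !mxE !enum_rankK /tent ?mxE.
Qed.

End ReflectionEquation.

Theorem proposition5 (K : realType) (n : nat) (R : 'TM[K[i]]_(n, 2))
    (k : nat) (alpha : K[i]) :
  yang_baxter R -> (0 < k)%N -> alpha != 0 ->
  exists theta : REA R -> 'TM[K[i]]_(n, k),
    [/\ theta_spec alpha theta,
        forall theta', theta_spec alpha theta' -> theta' =1 theta
      & is_representation theta].
Proof.
move=> YB _ _; have rel := jm_entry_rel k alpha YB.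
set M := jm_entry k R alpha in rel.
have theta_lin := rea_eval_linear rel.
have [theta1 thetaM] := rea_eval_morphism rel.
exists (rea_eval M); split; last by split.
  split=> // [i j|w]; first exact: rea_eval_gen.
  exact: (big_morph _ thetaM theta1).
move=> theta' [lin' one' gen' word'] u.
rewrite -[u]reprK -/(rea_pi R _) rea_eval_pi //.
apply: linear_on_words => // s; rewrite word'.
by apply: eq_bigr => l _; rewrite gen'.
Qed.
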